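(* Let $\lambda>0$, let $f$ be a finite DC function on $\mathbb{R}^n\times\mathbb{R}^m$, and let $K\subset\mathbb{R}^n\times\mathbb{R}^m$ be a convex set that is bounded in the variable $x$, with associated constants $M$, $\tau_0$ and $\theta_0$ as defined in the context. Consider the problem $$(P)\qquad\inf\{f(x,y)+\lambda\|x\|_0:(x,y)\in K\}.$$ (i) Suppose that $\sigma:\mathbb{R}\to\mathbb{R}$ satisfies, for some $\theta_{cap}>\theta_0$, $$\min\{\theta_{cap}|t|,1\}\le\sigma(t)\le s(t)\quad\forall t\in\mathbb{R},\qquad s(t)=\begin{cases}0&\text{if }t=0,\\1&\text{otherwise.}\end{cases}$$ Then problem $(P)$ and the problem $$\inf\Big\{f(x,y)+\lambda\sum_{i=1}^n\sigma(x_i):(x,y)\in K\Big\}$$ are equivalent, i.e. they have the same set of optimal solutions. (ii) In particular, let $a>1$ and let $r_{scad}$ be the SCAD approximation with parameters $a$ and $\theta_{scad}$ (defined in the context). If $\theta_{scad}>a\theta_0$, then the problem $$\inf\Big\{f(x,y)+\lambda\sum_{i=1}^n r_{scad}(x_i):(x,y)\in K\Big\}$$ is equivalent to $(P)$, i.e. it has the same set of optimal solutions as $(P)$.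
   Context: $\|x\|_0$ is the number of nonzero components of $x\in\mathbb{R}^n$. A finite DC function is a difference $g-h$ of two finite convex functions. $K$ bounded in the variable $x$ means $K\subset\prod_{i=1}^n[a_i,b_i]\times\mathbb{R}^m$ for some fixed reals $a_i\le0<b_i$. Put $c_i=\max\{|a_i|,|b_i|\}$ and $M=\max\{c_i:i=1,\dots,n\}$. For $\tau>0$ consider the penalized problem $$(P_\tau)\qquad\alpha(\tau):=\inf\Big\{f(x,y)+\lambda\sum_{i=1}^nu_i+\tau\sum_{i=1}^n\min\{u_i,1-u_i\}:(x,y)\in K,\ u\in[0,1]^n,\ |x_i|\le Mu_i,\ i=1,\dots,n\Big\}.$$ The number $\tau_0\ge0$ is an exact penalty threshold: for every $\tau>\tau_0$ the problems $(P)$ and $(P_\tau)$ are equivalent, in the sense that they have the same optimal value, and $(x^*,y^* )\in K$ is a solution of $(P)$ if and only if there is $u^*\in\{0,1\}^n$ such that $(x^*,y^*,u^* )$ is a solution of $(P_\tau)$. Then $$\theta_0:=\max\Big\{\frac{2}{M},\frac{\tau_0+\lambda}{\lambda M}\Big\}.$$ The SCAD approximation with parameters $a>1$ and $\theta=\theta_{scad}>0$ is $$r_{scad}(t)=\begin{cases}\frac{2\theta}{a+1}|t|&0\le|t|\le\frac1\theta,\\[2pt]\frac{-\theta^2t^2+2a\theta|t|-1}{a^2-1}&\frac1\theta<|t|<\frac a\theta,\\[2pt]1&|t|\ge\frac a\theta.\end{cases}$$ *)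

(* Defs.v *)
From HB Require Import structures.
From mathcomp Require Import all_boot all_order all_algebra.
From mathcomp Require Import all_classical all_reals all_analysis.
Set Implicit Arguments.
Unset Strict Implicit.
Unset Printing Implicit Defensive.
Import Order.TTheory GRing.Theory Num.Theory.
Local Open Scope classical_set_scope.
Local Open Scope ring_scope.

Section Minimization.
Context {R : realType} {T : Type}.

(* The minimization problem inf {F z : z in K} has an extended-real value:
   +oo when K is empty, -oo when F is unbounded below on K. *)
Definition optimal_value (K : set T) (F : T -> R) : \bar R :=
  ereal_inf [set (F z)%:E | z in K].

Definition solutions (K : set T) (F : T -> R) : set T :=
  [set z | K z /\ forall w, K w -> F z <= F w].

End Minimization.

Definition dc_function {R : realType} {E : lmodType R} (f : E -> R) : Prop :=
  exists g h : E -> R,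
    [/\ convex_function [set: convex_lmodType E] g,
        convex_function [set: convex_lmodType E] h &
        forall z, f z = g z - h z].

Section Sparse.
Context {R : realType} {n m : nat}.
Implicit Types (x u a b : 'rV[R]_n) (f : 'rV[R]_n * 'rV[R]_m -> R)
  (K : set ('rV[R]_n * 'rV[R]_m)).

Definition l0norm x : nat := #|[pred i : 'I_n | x 0 i != 0]|.

Definition l0_objective f (lambda : R) (z : 'rV[R]_n * 'rV[R]_m) : R :=
  f z + lambda * (l0norm z.1)%:R.

Definition approx_objective f (lambda : R) (sigma : R -> R)
    (z : 'rV[R]_n * 'rV[R]_m) : R :=
  f z + lambda * \sum_(i < n) sigma (z.1 0 i).

Definition bounded_in_x K a b : Prop :=
  (forall i, a 0 i <= 0 /\ 0 < b 0 i) /\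
  (forall z, K z -> forall i, a 0 i <= z.1 0 i <= b 0 i).

(* The default value 0 of the big maximum is harmless for n > 0, since all the
   terms are nonnegative. *)
Definition box_radius a b : R :=
  \big[Num.max/0]_(i < n) Num.max `|a 0 i| `|b 0 i|.

Definition penalized_feasible K (M : R)
    : set (('rV[R]_n * 'rV[R]_m) * 'rV[R]_n) :=
  [set w : ('rV[R]_n * 'rV[R]_m) * 'rV[R]_n |
    [/\ K w.1,
        forall i, 0 <= w.2 0 i <= 1 &
        forall i, `|w.1.1 0 i| <= M * w.2 0 i]].

Definition penalized_objective f (lambda tau : R)
    (w : ('rV[R]_n * 'rV[R]_m) * 'rV[R]_n) : R :=
  f w.1 + lambda * \sum_(i < n) w.2 0 i
    + tau * \sum_(i < n) Num.min (w.2 0 i) (1 - w.2 0 i).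

Definition exact_penalty_threshold f K (lambda M tau0 : R) : Prop :=
  0 <= tau0 /\
  forall tau, tau0 < tau ->
    optimal_value K (l0_objective f lambda) =
      optimal_value (penalized_feasible K M) (penalized_objective f lambda tau)
    /\
    forall z, K z ->
      (solutions K (l0_objective f lambda) z <->
       exists u, (forall i, u 0 i = 0 \/ u 0 i = 1) /\
         solutions (penalized_feasible K M)
           (penalized_objective f lambda tau) (z, u)).

End Sparse.

Section Approximation.
Context {R : realType}.

Definition theta_threshold (lambda M tau0 : R) : R :=
  Num.max (2 / M) ((tau0 + lambda) / (lambda * M)).

Definition step (t : R) : R := if t == 0 then 0 else 1.

Definition scad (a theta t : R) : R :=
  if `|t| <= theta^-1 then 2 * theta / (a + 1) * `|t|
  else if `|t| < a / theta then
    (- (theta ^+ 2) * t ^+ 2 + 2 * a * theta * `|t| - 1) / (a ^+ 2 - 1)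
  else 1.

End Approximation.

(* Main.v *)
(* Write [cap t = min (theta * |t|) 1].  As soon as [tau + lambda < lambda * theta * M],
   the choice [u = 1] if [1 <= theta * |t|] and [u = |t| / M] otherwise is feasible
   and costs at most [lambda * cap t], strictly less unless [u] is 0 or 1.  Hence
   for some [tau > tau0] the value of the approximate problem lies between
   [alpha(tau)] and the value of (P), which are equal; and at a solution of the
   approximate problem this [u] must be binary, so the penalty threshold makes it
   a solution of (P).  SCAD with parameters [a, theta] dominates [cap] with
   parameter [theta / a]. *)
Require Import Defs.
From HB Require Import structures.
From mathcomp Require Import all_boot all_order all_algebra.
From mathcomp Require Import all_classical all_reals all_analysis.
From mathcomp Require Import ring lra.
Set Implicit Arguments.
Unset Strict Implicit.
Unset Printing Implicit Defensive.
Import Order.TTheory GRing.Theory Num.Theory.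
Local Open Scope classical_set_scope.
Local Open Scope ring_scope.

(** Optimality becomes an inequality in the extended reals, so values of different problems chain by
    transitivity, with no case split on empty or unbounded ones. *)
Lemma solutions_le_optimal_value (R : realType) (T : Type) (K : set T)
    (F : T -> R) (z : T) :
  solutions K F z <-> K z /\ ((F z)%:E <= optimal_value K F)%E.
Proof.
split=> -[Kz Fz]; split=> //.
  by apply: le_ereal_inf_tmp => _ [w Kw <-]; rewrite lee_fin Fz.
move=> w Kw; rewrite -lee_fin; apply: (le_trans Fz).
by apply: ereal_inf_lbound; exists w.
Qed.

(** Used twice: with [p] the identity, and with [p] the lift [z] to [(z, u z)] into the penalized
    problem. *)
Lemma le_optimal_value (R : realType) (S T : Type) (K : set S) (L : set T)
    (F : S -> R) (G : T -> R) (p : T -> S) :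
  (forall w, L w -> K (p w) /\ F (p w) <= G w) ->
  (optimal_value K F <= optimal_value L G)%E.
Proof.
move=> FG; apply: le_ereal_inf_tmp => _ [w Lw <-].
have [Kpw le_FG] := FG w Lw.
apply: (@le_trans _ _ (F (p w))%:E); last by rewrite lee_fin.
by apply: ereal_inf_lbound; exists (p w).
Qed.

Section CappedRelaxation.
Context {R : realType} {lambda M theta tau : R}.
Hypotheses (lambda_gt0 : 0 < lambda) (M_gt0 : 0 < M) (tau_ge0 : 0 <= tau).
Hypothesis tau_lt : tau + lambda < lambda * (theta * M).

(** [|t| / M] is the least [u] that the constraint [|t| <= M * u] allows. *)
Definition cap_relax (t : R) : R := if 1 <= theta * `|t| then 1 else `|t| / M.

(** Hence [theta^-1 < M]: below the cap, [|t| / M] stays under 1. *)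
Let thetaM_gt1 : 1 < theta * M.
Proof.
by rewrite -(ltr_pM2l lambda_gt0) mulr1; apply: le_lt_trans tau_lt; rewrite lerDr.
Qed.

Let theta_gt0 : 0 < theta.
Proof. by rewrite -(pmulr_lgt0 _ M_gt0) (lt_trans ltr01). Qed.

Let below_cap (t : R) : theta * `|t| < 1 -> `|t| / M < 1.
Proof.
move=> lt1; rewrite ltr_pdivrMr // mul1r -(ltr_pM2l theta_gt0).
exact: lt_trans thetaM_gt1.
Qed.

Lemma cap_relax_itv t : 0 <= cap_relax t <= 1.
Proof.
rewrite /cap_relax; case: (leP 1) => [_|/below_cap/ltW ->]; first by rewrite ler01 lexx.
by rewrite divr_ge0 // ltW.
Qed.

Lemma norm_le_cap_relax (t : R) : `|t| <= M -> `|t| <= M * cap_relax t.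
Proof.
rewrite /cap_relax; case: (leP 1) => _ tM; first by rewrite mulr1.
by rewrite mulrC divfK // gt_eqF.
Qed.

(** Below the cap, [Num.min u (1 - u) <= u] bounds the left side by [(tau + lambda) * u], which for
    [t != 0] is strictly less than [lambda * (theta * M) * u], the right side. The [?= iff] form
    keeps the equality case available after summation. *)
Lemma cap_relax_leif (t : R) (u := cap_relax t) :
  lambda * u + tau * Num.min u (1 - u) <= lambda * Num.min (theta * `|t|) 1
    ?= iff ((u == 0) || (u == 1)).
Proof.
rewrite /u /cap_relax; case: (leP 1) => [ge1|lt1].
  by rewrite subrr eqxx orbT (min_r ler01) mulr0 addr0 mulr1; exact: leif_refl.
have [->|t0] := eqVneq t 0.
  by rewrite normr0 mul0r eqxx subr0 !(min_l ler01) !mulr0 addr0; exact: leif_refl.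
have t_gt0 : 0 < `|t| by rewrite normr_gt0.
have v_gt0 : 0 < `|t| / M by rewrite divr_gt0.
rewrite (gt_eqF v_gt0) (lt_eqF (below_cap lt1)) /=.
suff lt_cost : lambda * (`|t| / M) + tau * Num.min (`|t| / M) (1 - `|t| / M)
    < lambda * (theta * `|t|).
  by split; [exact: ltW | rewrite lt_eqF].
have -> : lambda * (theta * `|t|) = lambda * (theta * M) * (`|t| / M).
  by field; rewrite gt_eqF.
apply: (@le_lt_trans _ _ ((tau + lambda) * (`|t| / M))); last by rewrite ltr_pM2r.
by rewrite [leRHS]mulrDl addrC lerD2r ler_wpM2l // ge_min lexx.
Qed.

End CappedRelaxation.

Section BoxBounds.
Context {R : realType} {n m : nat}.
Implicit Types a b : 'rV[R]_n.

Lemma le_box_radius a b i : Num.max `|a 0 i| `|b 0 i| <= box_radius a b.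
Proof. exact: (le_bigmax _ (fun i => Num.max `|a 0 i| `|b 0 i|)). Qed.

(** Strictness comes from some [b 0 i > 0], so an index must exist: for [n = 0] the maximum is its
    default 0. *)
Lemma box_radius_gt0 a b (K : set ('rV[R]_n * 'rV[R]_m)) :
  (0 < n)%N -> bounded_in_x K a b -> 0 < box_radius a b.
Proof.
move=> n_gt0 [ab _]; apply: lt_le_trans (le_box_radius a b (Ordinal n_gt0)).
by rewrite lt_max !normr_gt0 (gt_eqF (ab _).2) orbT.
Qed.

Lemma bounded_in_x_norm a b (K : set ('rV[R]_n * 'rV[R]_m)) z i :
  bounded_in_x K a b -> K z -> `|z.1 0 i| <= box_radius a b.
Proof.
move=> [ab Kab] Kz; apply: le_trans (le_box_radius a b i).
have /andP[az zb] := Kab z Kz i; have [a_le0 b_gt0] := ab i.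
by rewrite le_max (ler0_norm a_le0) (gtr0_norm b_gt0); case: (ger0P (z.1 0 i)); lra.
Qed.

(** Presents (P) as the case [sigma = step], to be compared term by term. *)
Lemma l0normE (x : 'rV[R]_n) : (l0norm x)%:R = \sum_(i < n) step (x 0 i).
Proof.
rewrite /l0norm -sum1_card natr_sum big_mkcond /=.
by apply: eq_bigr => i _; rewrite /step inE; case: eqP.
Qed.

End BoxBounds.

Lemma solutions_approx (R : realType) (n m : nat) (lambda : R)
    (f : 'rV[R]_n * 'rV[R]_m -> R) (K : set ('rV[R]_n * 'rV[R]_m))
    (M tau0 theta : R) (sigma : R -> R) :
  0 < lambda -> 0 < M -> (forall z i, K z -> `|z.1 0 i| <= M) ->
  exact_penalty_threshold f K lambda M tau0 ->
  (tau0 + lambda) / (lambda * M) < theta ->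
  (forall t, Num.min (theta * `|t|) 1 <= sigma t <= step t) ->
  solutions K (l0_objective f lambda) =
  solutions K (approx_objective f lambda sigma).
Proof.
move=> lambda_gt0 M_gt0 KM [tau0_ge0 tau0P] theta_gt sigmaP.
have {}theta_gt : tau0 + lambda < lambda * (theta * M).
  by move: theta_gt; rewrite ltr_pdivrMr ?mulr_gt0 // mulrCA.
pose tau := (tau0 + (lambda * (theta * M) - lambda)) / 2.
have tau0_lt : tau0 < tau by rewrite /tau; lra.
have tau_lt : tau + lambda < lambda * (theta * M) by rewrite /tau; lra.
have tau_ge0 : 0 <= tau by rewrite ltW // (le_lt_trans tau0_ge0).
have [opt_eq solP] := tau0P tau tau0_lt.
pose u (z : 'rV[R]_n * 'rV[R]_m) := \row_i @cap_relax R M theta (z.1 0 i).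
have u_feas z : K z -> penalized_feasible K M (z, u z).
  move=> Kz; split=> // i; rewrite mxE; first exact: cap_relax_itv tau_lt _.
  exact/norm_le_cap_relax/KM.
(* Equality of the sums forces equality in each coordinate, hence a binary [u z]. *)
have u_cost z : penalized_objective f lambda tau (z, u z)
    <= f z + lambda * \sum_(i < n) Num.min (theta * `|z.1 0 i|) 1
    ?= iff [forall i, (u z 0 i == 0) || (u z 0 i == 1)].
  rewrite /penalized_objective -addrA !mulr_sumr -big_split /=.
  apply: (@leifD _ _ _ true); first exact/leif_refl.
  apply: (@leif_sum _ _ predT (fun i => (u z 0 i == 0) || (u z 0 i == 1))) => i _.
  rewrite mxE.
  exact: cap_relax_leif.
have cap_le z : f z + lambda * \sum_(i < n) Num.min (theta * `|z.1 0 i|) 1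
    <= approx_objective f lambda sigma z.
  rewrite lerD2l ler_pM2l //; apply: ler_sum => i _.
  by have /andP[] := sigmaP (z.1 0 i).
have approx_le z : approx_objective f lambda sigma z <= l0_objective f lambda z.
  rewrite lerD2l ler_pM2l // l0normE; apply: ler_sum => i _.
  by have /andP[] := sigmaP (z.1 0 i).
have opt_approx_le : (optimal_value K (approx_objective f lambda sigma)
    <= optimal_value K (l0_objective f lambda))%E.
  by apply: (@le_optimal_value _ _ _ _ _ _ _ id).
have opt_le_approx : (optimal_value K (l0_objective f lambda)
    <= optimal_value K (approx_objective f lambda sigma))%E.
  rewrite opt_eq; apply: (@le_optimal_value _ _ _ _ _ _ _ (fun z => (z, u z))).
  by move=> z Kz; split; [exact: u_feas | exact: le_trans (u_cost z) (cap_le z)].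
apply/seteqP; split=> z /solutions_le_optimal_value[Kz zP].
  apply/solutions_le_optimal_value; split=> //.
  by apply: le_trans opt_le_approx; apply: le_trans zP; rewrite lee_fin.
(* From here [z] solves the approximate problem; its capped cost is at most the penalized optimal
   value. *)
have cap_le_opt := le_trans zP opt_approx_le.
rewrite opt_eq in cap_le_opt.
have {}cap_le_opt : ((f z + lambda * \sum_(i < n) Num.min (theta * `|z.1 0 i|) 1)%:E
    <= optimal_value (penalized_feasible K M) (penalized_objective f lambda tau))%E.
  by apply: le_trans cap_le_opt; rewrite lee_fin.
have opt_le_u : (optimal_value (penalized_feasible K M)
    (penalized_objective f lambda tau)
    <= (penalized_objective f lambda tau (z, u z))%:E)%E.
  by apply: ereal_inf_lbound; exists (z, u z); first exact: u_feas.
(* The penalized cost of [(z, u z)] is squeezed between the penalized optimal value and the capped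
   cost, so equality holds in [u_cost]. *)
have /forallP u_bin : [forall i, (u z 0 i == 0) || (u z 0 i == 1)].
  rewrite -(u_cost z) eq_le (u_cost z) /= -lee_fin.
  exact: le_trans opt_le_u.
apply/(solP z Kz); exists (u z); split.
  by move=> i; case/orP: (u_bin i) => /eqP; [left | right].
apply/solutions_le_optimal_value; split; first exact: u_feas.
by apply: le_trans cap_le_opt; rewrite lee_fin; exact: (u_cost z).
Qed.

(** Everything depends on [s = theta * |t|] alone. On the linear piece, [s / a <= 2 * s / (a + 1)]
    because [a + 1 <= 2 * a]. *)
Lemma scad_bounds (R : realType) (a theta t : R) : 1 < a -> 0 < theta ->
  Num.min (theta / a * `|t|) 1 <= scad a theta t <= step t.
Proof.
move=> a_gt1 theta_gt0.
have a_gt0 : 0 < a by lra.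
have a1_gt0 : 0 < a + 1 by lra.
have aa_gt0 : 0 < a ^+ 2 - 1 by nra.
rewrite /scad /step; have [->|t0] := eqVneq t 0.
  by rewrite normr0 invr_ge0 (ltW theta_gt0) !mulr0 (min_l ler01) lexx.
have -> : (`|t| <= theta^-1) = (theta * `|t| <= 1).
  by rewrite -[theta^-1]mul1r ler_pdivlMr // mulrC.
have -> : (`|t| < a / theta) = (theta * `|t| < a) by rewrite ltr_pdivlMr // mulrC.
have s_gt0 : 0 < theta * `|t| by rewrite mulr_gt0 ?normr_gt0.
have -> : theta / a * `|t| = theta * `|t| / a by rewrite mulrAC.
have -> : 2 * theta / (a + 1) * `|t| = 2 * (theta * `|t|) / (a + 1).
  by rewrite mulrAC -!mulrA.
have -> : - (theta ^+ 2) * t ^+ 2 + 2 * a * theta * `|t| - 1 =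
    - (theta * `|t|) ^+ 2 + 2 * a * (theta * `|t|) - 1.
  by rewrite exprMn real_normK ?num_real //; ring.
set s := theta * `|t| in s_gt0 *.
rewrite ge_min; case: (leP s 1) => [s1|s1].
  rewrite !ler_pdivrMr // mulrAC ler_pdivlMr // mul1r.
  by apply/andP; split; [apply/orP; left; nra | lra].
case: (ltP s a) => [sa|sa]; last by rewrite !lexx orbT.
rewrite !ler_pdivrMr // mulrAC ler_pdivlMr // mul1r.
(* The upper bound amounts to [0 <= (a - s) ^+ 2]. *)
apply/andP; split; last by nra.
apply/orP; left; rewrite -subr_ge0.
(* Both factors are nonnegative because [1 < s < a]. *)
rewrite (_ : _ - _ = (a - s) * (a * s - 1)); last by ring.
by apply: mulr_ge0; nra.
Qed.

Theorem proposition5 (R : realType) (n m : nat) (hn : (0 < n)%N)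
    (lambda : R) (hlambda : 0 < lambda)
    (f : 'rV[R]_n * 'rV[R]_m -> R) (hf : dc_function f)
    (K : set ('rV[R]_n * 'rV[R]_m))
    (hK : convex_set (K : set (convex_lmodType ('rV[R]_n * 'rV[R]_m)%type)))
    (a b : 'rV[R]_n) (hab : bounded_in_x K a b)
    (tau0 : R)
    (htau0 : exact_penalty_threshold f K lambda (box_radius a b) tau0) :
  let theta0 := theta_threshold lambda (box_radius a b) tau0 in
  (forall (sigma : R -> R) (theta_cap : R),
      theta0 < theta_cap ->
      (forall t, Num.min (theta_cap * `|t|) 1 <= sigma t <= step t) ->
      solutions K (l0_objective f lambda) =
      solutions K (approx_objective f lambda sigma)) /\
  (forall a_scad theta_scad : R,
      1 < a_scad -> 0 < theta_scad ->
      a_scad * theta0 < theta_scad ->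
      solutions K (l0_objective f lambda) =
      solutions K (approx_objective f lambda (scad a_scad theta_scad))).
Proof.
move=> theta0; have M_gt0 := box_radius_gt0 hn hab.
have capP sigma theta_cap : theta0 < theta_cap ->
    (forall t, Num.min (theta_cap * `|t|) 1 <= sigma t <= step t) ->
    solutions K (l0_objective f lambda) =
    solutions K (approx_objective f lambda sigma).
  rewrite gt_max => /andP[_ theta_gt]; apply: solutions_approx htau0 theta_gt => //.
  by move=> z i; exact: bounded_in_x_norm.
split=> // a_scad theta_scad a_gt1 theta_gt0 theta_gt.
apply: (capP _ (theta_scad / a_scad)) => [|t]; last exact: scad_bounds.
by rewrite ltr_pdivlMr ?(lt_trans ltr01) // mulrC.
Qed.
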